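(* Every symmetric convex body $K \subset \mathbb{R}^2$ is intuitive. That is, for every finite non-empty set $P \subset \mathbb{R}^2$ and every probability distribution $W$ on $P$, $\mathsf{GM}_K(W) \cap \mathsf{conv}(P) \neq \emptyset$.
   Context: A symmetric convex body $K \subset \mathbb{R}^n$ is a compact convex set with non-empty interior such that $K = -K$. It defines the norm $\|\xi\|_K = \inf\{t > 0 : \xi \in tK\}$ on $\mathbb{R}^n$. For a finite set $P \subset \mathbb{R}^n$, $\Delta_P$ denotes the set of probability distributions on $P$ (weights $W(p)\ge 0$ for $p \in P$ summing to $1$). For $W \in \Delta_P$, the geometric median $\mathsf{GM}_K(W)$ is the set of all minimizers over $\xi \in \mathbb{R}^n$ of the function $F_{K,W}(\xi) = \sum_{p \in P} W(p)\,\|\xi - p\|_K$. $\mathsf{conv}(P)$ is the convex hull of $P$. The body $K$ is called intuitive if for every finite non-empty $P \subset \mathbb{R}^n$ and every $W \in \Delta_P$ one has $\mathsf{GM}_K(W) \cap \mathsf{conv}(P) \neq \emptyset$. *)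

(* Defs.v *)
From HB Require Import structures.
From mathcomp Require Import all_boot all_order all_algebra.
From mathcomp Require Import finmap.
From mathcomp Require Import all_classical all_reals all_analysis.
Set Implicit Arguments.
Unset Strict Implicit.
Unset Printing Implicit Defensive.
Import Order.TTheory GRing.Theory Num.Theory.
Import numFieldNormedType.Exports.
Local Open Scope classical_set_scope.
Local Open Scope ring_scope.

Section GeometricMedian.
Context {R : realType} {n : nat}.
Local Notation V := 'rV[R]_n.

Definition symmetric_convex_body (K : set V) : Prop :=
  [/\ compact K, convex_set K, K° !=set0 & K = [set - x | x in K]].

Definition body_norm (K : set V) (xi : V) : R :=
  inf [set t : R | 0 < t /\ [set t *: x | x in K] xi].

(* A distribution on [P] is a function on the whole space of which the
   values outside [P] are never used. *)
Definition distributions (P : {fset V}) : set (V -> R) :=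
  [set W | (forall p, p \in P -> 0 <= W p) /\ \sum_(p <- P) W p = 1].

Definition median_cost (K : set V) (P : {fset V}) (W : V -> R) (xi : V) : R :=
  \sum_(p <- P) W p * body_norm K (xi - p).

Definition geometric_median (K : set V) (P : {fset V}) (W : V -> R) : set V :=
  [set xi | forall eta, median_cost K P W xi <= median_cost K P W eta].

Definition convex_hull (A : set V) : set V :=
  smallest (fun B : set V => convex_set B) A.

Definition intuitive (K : set V) : Prop :=
  forall P : {fset V}, P != fset0 ->
  forall W : V -> R, distributions P W ->
  geometric_median K P W `&` convex_hull [set` P] !=set0.

End GeometricMedian.

(* Main.v *)
Require Import Defs.
From mathcomp Require Import all_boot all_order all_algebra.
From mathcomp Require Import finmap.
From mathcomp Require Import all_classical all_reals all_analysis.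
From mathcomp Require Import ring lra.
Import Order.TTheory GRing.Theory Num.Theory.
Import numFieldNormedType.Exports.
Local Open Scope classical_set_scope.
Local Open Scope ring_scope.

(* For a closed half-plane H with boundary direction u, a direction v in the
   kernel of a functional supporting N at u projects the plane onto H without
   increasing the N-distance to any point of H. When N is perturbed to
   N + e * (Euclidean norm) the decrease is strict for points outside H, so every
   minimiser of the perturbed cost lies in every half-plane containing P, that
   is, in conv(P). Letting e tend to 0, the minimiser of the original cost over
   the compact set conv(P) is a global minimiser. *)

(** * Seminorms: supporting functionals and continuity *)

Definition seminorm {R : realType} {V : lmodType R} (N : V -> R) : Prop :=
  (forall x y, N (x + y) <= N x + N y) /\
  (forall c x, N (c *: x) = `|c| * N x).

Section Seminorm.
Context {R : realType} {V : lmodType R} {N : V -> R} (hN : seminorm N).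

Lemma seminormD x y : N (x + y) <= N x + N y. Proof. exact: hN.1. Qed.

Lemma seminormZ c x : N (c *: x) = `|c| * N x. Proof. exact: hN.2. Qed.

Lemma seminorm0 : N 0 = 0.
Proof. by rewrite -(scale0r 0) seminormZ normr0 mul0r. Qed.

Lemma seminormN x : N (- x) = N x.
Proof. by rewrite -scaleN1r seminormZ normrN1 mul1r. Qed.

Lemma seminorm_ge0 x : 0 <= N x.
Proof.
have := seminormD x (- x); rewrite subrr seminorm0 seminormN.
lra.
Qed.

Lemma seminorm_dist x y : `|N x - N y| <= N (x - y).
Proof.
have h1 := seminormD (x - y) y; have h2 := seminormD (y - x) x.
rewrite subrK in h1; rewrite subrK -opprB seminormN in h2.
rewrite ler_norml; lra.
Qed.

(* The Hahn-Banach theorem on the plane spanned by [u] and [w]: the functional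
   [s u + t w |-> s N(u) + t c] is dominated by [N] and exact at [u]. *)
Lemma seminorm_support u w :
  exists c, forall s t, s * N u + t * c <= N (s *: u + t *: w).
Proof.
pose A := [set N (s *: u + w) - s * N u | s in setT].
(* The lower bounds on [c] forced by [t = -1] never exceed the upper bounds forced by [t = 1]. So
   [inf A] meets both, and the other nonzero [t] follow by scaling. *)
have key s r : s * N u - N (s *: u - w) <= N (r *: u + w) - r * N u.
  have h := seminormD (s *: u - w) (r *: u + w).
  rewrite {1}[r *: u + w]addrC addrA subrK -scalerDl seminormZ in h.
  have h' := ler_wpM2r (seminorm_ge0 u) (ler_norm (s + r)); lra.
have lA s : s * N u - N (s *: u - w) <= inf A.
  apply: lb_le_inf; first by exists (N (0 *: u + w) - 0 * N u), 0.
  by move=> _ [r _ <-]; exact: key.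
have uA s : inf A <= N (s *: u + w) - s * N u.
  apply: ge_inf; last by exists s.
  by exists (0 * N u - N (0 *: u - w)) => _ [r _ <-]; exact: key.
exists (inf A) => s t; have [t0|t0|->] := ltrgtP t 0.
- have h := lA (s / - t).
  have -> : s *: u + t *: w = (- t) *: ((s / - t) *: u - w).
    rewrite scalerBr scalerA mulrCA divff ?oppr_eq0 ?lt_eqF// mulr1.
    by rewrite scaleNr opprK.
  rewrite seminormZ gtr0_norm ?oppr_gt0//.
  have e : (- t) * (s / - t * N u) = s * N u.
    by field; rewrite lt_eqF.
  have t0' : 0 <= - t by rewrite oppr_ge0 ltW.
  have := ler_wpM2l t0' h; rewrite mulrBr e; lra.
- have h := uA (s / t).
  have -> : s *: u + t *: w = t *: ((s / t) *: u + w).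
    by rewrite scalerDr scalerA mulrCA divff ?gt_eqF// mulr1.
  rewrite seminormZ gtr0_norm//.
  have e : t * (s / t * N u) = s * N u by field; rewrite gt_eqF.
  have := ler_wpM2l (ltW t0) h; rewrite mulrBr e; lra.
- rewrite mul0r addr0 scale0r addr0 seminormZ.
  exact: ler_wpM2r (seminorm_ge0 u) _ _ (ler_norm s).
Qed.

End Seminorm.

Lemma seminorm_add {R : realType} {V : lmodType R} {N E : V -> R} {e : R} :
  0 <= e -> seminorm N -> seminorm E ->
  seminorm (fun x => N x + e * E x).
Proof.
move=> e0 [ND NZ] [ED EZ]; split=> [x y|c x].
  have := ND x y; have := ler_wpM2l e0 (ED x y); lra.
by rewrite NZ EZ; ring.
Qed.

(** Expansion in the standard basis bounds [N] by [L] times the maximum norm, and the reverse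
    triangle inequality turns this into a Lipschitz bound. *)
Lemma seminorm_continuous {R : realType} {n} {N : 'rV[R]_n -> R} :
  seminorm N -> continuous N.
Proof.
move=> hN.
pose L := \sum_(i < n) N (delta_mx 0 i).
have L0 : 0 <= L by apply: sumr_ge0 => i _; exact: (seminorm_ge0 hN).
have NL x : N x <= L * `|x|.
  rewrite {1}(row_sum_delta x) /L mulr_suml.
  elim/big_ind2 : _ => [|a b c d ab cd|i _].
  - by rewrite (seminorm0 hN).
  - exact: le_trans (seminormD hN _ _) (lerD ab cd).
  - rewrite (seminormZ hN) mulrC ler_wpM2l ?(seminorm_ge0 hN)//.
    rewrite [leRHS]/Num.norm /= mx_normrE.
    by apply/bigmax_geP; right => /=; exists (0, i).
move=> x; apply/(@cvgrPdist_le _ _ _ (nbhs x) (nbhs_filter x)) => /= e e0.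
(* [L] may be zero, so the division below uses [L + 1]. *)
have L1 : 0 < L + 1 by lra.
have h0 : \forall y \near x, `|x - y| <= e / (L + 1).
  have /(@cvgrPdist_le _ _ _ (nbhs x) (nbhs_filter x)) := @cvg_id _ (nbhs x).
  by apply; rewrite divr_gt0.
near=> y.
apply: le_trans (seminorm_dist hN x y) _.
apply: le_trans (NL _) _.
apply: (@le_trans _ _ ((L + 1) * `|x - y|)).
  by rewrite ler_wpM2r//; lra.
rewrite -ler_pdivlMl// mulrC; near: y.
exact: h0.
Unshelve. all: by end_near.
Qed.

(** * Euclidean geometry of the plane and the strictly decreasing shift *)

Section Plane.
Context {R : realType}.
Implicit Types x y a : 'rV[R]_2.

Definition dot x y : R := x 0 0 * y 0 0 + x 0 1 * y 0 1.

(** Rotation by a quarter turn. *)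
Definition perp a : 'rV[R]_2 := \row_j (if j == 0 then - a 0 1 else a 0 0).

(** The Euclidean norm; on row vectors [|x|] is the maximum norm. *)
Definition enorm x : R := Num.sqrt (dot x x).

Lemma dot_ge0 x : 0 <= dot x x.
Proof. by rewrite /dot; nra. Qed.

Lemma dot_eq0 x : dot x x = 0 -> x = 0.
Proof.
rewrite /dot => h; apply/rowP => -[[|[|//]] i]; rewrite mxE.
- by rewrite (_ : Ordinal i = 0); [nra|exact/val_inj].
- by rewrite (_ : Ordinal i = 1); [nra|exact/val_inj].
Qed.

Lemma enorm_ge0 x : 0 <= enorm x. Proof. exact: sqrtr_ge0. Qed.

Lemma sqr_enorm x : enorm x ^+ 2 = dot x x.
Proof. by rewrite sqr_sqrtr ?dot_ge0. Qed.

Lemma enorm_seminorm : seminorm enorm.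
Proof.
split=> [x y|c x].
- rewrite -ler_sqr ?nnegrE ?addr_ge0 ?enorm_ge0//.
  rewrite sqrrD !sqr_enorm.
  suff : dot x y <= enorm x * enorm y by rewrite /dot !mxE; nra.
  rewrite -sqrtrM ?dot_ge0//.
  apply: le_trans (ler_norm _) _.
  rewrite -sqrtr_sqr ler_wsqrtr// /dot.
  (* Lagrange's identity: this square equals [dot x x * dot y y - dot x y ^+ 2]. *)
  have := sqr_ge0 (x 0 0 * y 0 1 - x 0 1 * y 0 0); nra.
- rewrite /enorm (_ : dot _ _ = c ^+ 2 * dot x x).
    by rewrite sqrtrM ?sqr_ge0// sqrtr_sqr.
  by rewrite /dot !mxE; ring.
Qed.

Lemma normr_le_enorm x : `|x| <= enorm x.
Proof.
rewrite {1}/Num.norm /= mx_normrE; apply/bigmax_leP; split=> [|[i j] _ /=].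
  exact: enorm_ge0.
rewrite -sqrtr_sqr ler_wsqrtr// /dot (ord1 i).
case: j => -[|[|//]] k.
- by rewrite (_ : Ordinal k = 0); [nra|exact/val_inj].
- by rewrite (_ : Ordinal k = 1); [nra|exact/val_inj].
Qed.

Lemma perp_decomposition a x : a != 0 ->
  x = (dot (perp a) x / dot a a) *: perp a + (dot a x / dot a a) *: a.
Proof.
move=> a0.
have d0 : a 0 0 * a 0 0 + a 0 1 * a 0 1 != 0.
  by apply: contra_neq a0; exact: dot_eq0.
apply/rowP => -[[|[|//]] i]; rewrite /dot !mxE.
- by rewrite (_ : Ordinal i = 0) /=; [field|exact/val_inj].
- by rewrite (_ : Ordinal i = 1) /=; [field|exact/val_inj].
Qed.

(* [v] lies in the kernel of a functional supporting [N + e * enorm] at [perp a],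
   and [dot a v = dot a a], so [x - v] stays on the same side of the line
   [dot a = 0]. *)
Lemma shift_decrease (N : 'rV[R]_2 -> R) (e : R) a :
  seminorm N -> 0 < e -> a != 0 ->
  exists v, forall x, dot a a <= dot a x ->
    N (x - v) + e * enorm (x - v) < N x + e * enorm x.
Proof.
move=> hN e0 a0; set M := fun x => N x + e * enorm x.
have hM : seminorm M := seminorm_add (ltW e0) hN enorm_seminorm.
have d0 : 0 < dot a a.
  by rewrite lt_neqAle dot_ge0 andbT eq_sym; apply: contra_neq a0; exact: dot_eq0.
set u := perp a.
have uu : dot u u = dot a a by rewrite /u /dot !mxE /=; ring.
have eu0 : 0 < enorm u by rewrite sqrtr_gt0 uu.
have Mu0 : 0 < M u.
  by rewrite /M; have := seminorm_ge0 hN u; have := mulr_gt0 e0 eu0; lra.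
(* Supporting [N] alone is enough: [enorm] is supported at [u] by a functional vanishing on [a], so
   the functional with value [M u] at [u] and [c] at [a] supports [M]. The vector chosen next is in
   its kernel. *)
have [c hc] := seminorm_support hN u a.
exists (a - (c / M u) *: u) => x hx.
set v := a - _; change (M (x - v) < M x).
set r := dot a x / dot a a; set s' := dot u x / dot a a.
have r1 : 1 <= r by rewrite ler_pdivlMr// mul1r.
have xE : x = s' *: u + r *: a by exact: perp_decomposition.
pose s := s' + r * (c / M u).
have xE' : x = s *: u + r *: v.
  by rewrite {1}xE; apply/rowP => i; rewrite /v /s !mxE; ring.
have xx : dot x x = (s' ^+ 2 + r ^+ 2) * dot a a.
  by rewrite [in LHS]xE /u /dot !mxE /=; ring.
(* The component [r *: a] is nonzero and orthogonal to [u]. This is where the Euclidean term makes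
   the decrease strict. *)
have strict : `|s'| * enorm u < enorm x.
  rewrite -ltr_sqr ?nnegrE ?mulr_ge0 ?enorm_ge0// exprMn real_normK ?num_real//.
  by rewrite !sqr_enorm uu xx ltr_pM2r// ltrDl exprn_gt0//; lra.
(* [s * M u] is the value of the functional at [x]; the support inequality at [x] and at [- x]
   bounds both signs. *)
have sM : `|s| * M u < M x.
  have sE : s * M u = s' * M u + r * c.
    by rewrite /s; field; rewrite gt_eqF.
  have h1 := hc s' r; rewrite -xE in h1.
  have h2 := hc (- s') (- r).
  rewrite !scaleNr -opprD -xE (seminormN hN) in h2.
  have := ltr_pM2l e0 (`|s'| * enorm u) (enorm x); rewrite strict => h3.
  have h4 := ler_wpM2l (ltW (mulr_gt0 e0 eu0)) (ler_norm s').
  have h5 := ler_wpM2l (ltW (mulr_gt0 e0 eu0)) (ler_norm (- s')).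
  rewrite normrN in h5.
  rewrite -[M u in X in X < _]gtr0_norm// -normrM sE /M ltr_norml.
  by apply/andP; split; lra.
(* [x - v] is the convex combination of [s *: u] and [x] with weights [1 / r] and [1 - 1 / r]. *)
have conv : r * M (x - v) <= `|s| * M u + (r - 1) * M x.
  have -> : r * M (x - v) = M (s *: u + (r - 1) *: x).
    rewrite -{1}[r]gtr0_norm ?(lt_le_trans ltr01)// -(seminormZ hM).
    have -> : s *: u = x - r *: v by rewrite {1}xE' addrK.
    by congr M; apply/rowP => i; rewrite !mxE; ring.
  apply: le_trans (seminormD hM _ _) _.
  by rewrite !(seminormZ hM) (ger0_norm (_ : 0 <= r - 1))// subr_ge0.
have : r * M (x - v) < r * M x by lra.
by rewrite ltr_pM2l//; lra.
Qed.

End Plane.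

(** * Convex hulls of finite sequences *)

Section FiniteHull.
Context {R : realType} {n : nat}.
Implicit Types (s : seq 'rV[R]_n) (A : set 'rV[R]_n).

Definition simplex m : set 'rV[R]_m :=
  [set w | (forall i, 0 <= w 0 i) /\ \sum_i w 0 i = 1].

(** Barycentric form of the convex hull: as a continuous image of the simplex it is visibly
    compact. *)
Definition hull s : set 'rV[R]_n :=
  [set \sum_(i < size s) w 0 i *: s`_i | w in simplex (size s)].

(** A closed subset of the unit cube: each weight is at most the total. *)
Lemma simplex_compact m : compact (simplex m).
Proof.
apply: (@subclosed_compact _ _
    [set w : 'rV[R]_m | forall i, `[0, 1]%classic (w 0 i)]).
- have -> : simplex m = \bigcap_(i in [set: 'I_m])
      ((fun w : 'rV[R]_m => w 0 i) @^-1` [set y | 0 <= y]) `&`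
      ((fun w : 'rV[R]_m => \sum_i w 0 i) @^-1` [set 1]).
    apply/seteqP; split => w [w0 w1]; split => // i; last exact: w0.
    by move=> _; exact: w0.
  apply: closedI.
  + apply: closed_bigI => i _.
    apply: preimage_closed => [w _|]; [exact: coord_continuous|exact: closed_ge].
  + apply: preimage_closed => [w _|]; last exact: closed_eq.
    apply: (continuous_big add_continuous) => i _; exact: coord_continuous.
- apply: (@rV_compact R m (fun=> `[0, 1]%classic)) => _.
  exact: segment_compact.
- move=> w [w0 w1] i /=; rewrite in_itv /= w0 /= -w1 (bigD1 i)//= lerDl.
  by rewrite sumr_ge0.
Qed.

Lemma hull_compact s : compact (hull s).
Proof.
apply: continuous_compact; last exact: simplex_compact.
apply/continuous_subspaceT/(continuous_big add_continuous) => i _ w.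
apply: (@cvgZr_tmp _ _ _ (nbhs w) _ (fun w => w 0 i)).
exact: coord_continuous.
Qed.

(** The weights move linearly towards the vertex of the simplex at the first index of [p]. *)
Lemma hull_segment s x p t : hull s x -> p \in s -> 0 <= t <= 1 ->
  hull s (x + t *: (p - x)).
Proof.
move=> [w [w0 w1] <-] ps /andP[t0 t1].
have ips : (index p s < size s)%N by rewrite index_mem.
pose d : 'rV[R]_(size s) := delta_mx 0 (Ordinal ips).
have dE : \sum_i d 0 i = 1.
  rewrite (bigD1 (Ordinal ips))//= big1 ?addr0 => [|i /negbTE h].
    by rewrite mxE !eqxx.
  by rewrite mxE h andbF.
exists (w + t *: (d - w)); first split.
- move=> i; rewrite !mxE eqxx /=; have := w0 i.
  by case: (_ == _) => /=; nra.
- rewrite (eq_bigr (fun i => w 0 i + t * (d 0 i - w 0 i))); last first.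
    by move=> i _; rewrite !mxE.
  by rewrite big_split /= -mulr_sumr sumrB dE w1 subrr mulr0 addr0.
- rewrite (eq_bigr (fun i : 'I_(size s) => w 0 i *: s`_i
      + t *: (d 0 i *: s`_i - w 0 i *: s`_i))); last first.
    by move=> i _; apply/rowP => j; rewrite !mxE; ring.
  rewrite big_split /= -scaler_sumr sumrB; congr (_ + _ *: (_ - _)).
  rewrite (bigD1 (Ordinal ips))//= big1 ?addr0 => [|i /negbTE h].
    by rewrite mxE !eqxx scale1r nth_index.
  by rewrite mxE h andbF scale0r.
Qed.

(** Induction on the number of points. Leaving the weights unnormalised lets the tail be an instance
    of the same statement, unless its total weight is zero. *)
Lemma convex_set_comb A m (w : 'I_m -> R) (x : 'I_m -> 'rV[R]_n) :
  convex_set A -> (forall i, 0 <= w i) -> (forall i, A (x i)) ->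
  0 < \sum_i w i -> A ((\sum_i w i)^-1 *: \sum_i w i *: x i).
Proof.
move=> cA; elim: m w x => [|m IH] w x w0 Ax; first by rewrite big_ord0 ltxx.
rewrite !big_ord_recl; set W := \sum_i _; set X := \sum_i _ => W0.
have : 0 <= W by apply: sumr_ge0.
rewrite le_eqVlt => /predU1P[Wz|Wp].
  have -> : X = 0.
    rewrite /X big1// => i _; suff -> : w (lift ord0 i) = 0 by rewrite scale0r.
    apply/eqP; move/esym/eqP : Wz; rewrite psumr_eq0// => /allP; apply.
    by rewrite mem_index_enum.
  rewrite -Wz !addr0 scalerA mulVf ?scale1r//; last first.
    by move: W0; rewrite -Wz addr0 => /gt_eqF ->.
have AX : A (W^-1 *: X) by apply: IH => // i; exact: w0.
have l0 : 0 <= w ord0 / (w ord0 + W) by rewrite divr_ge0// ltW.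
have l1 : w ord0 / (w ord0 + W) <= 1 by rewrite ler_pdivrMr// mul1r; lra.
pose l : {i01 R} := Itv01 l0 l1.
have /set_mem := cA (x ord0) (W^-1 *: X) l (mem_set (Ax ord0)) (mem_set AX).
rewrite -[conv _ _ _]/(_ *: _ + (1 - _) *: _) /=; congr A.
rewrite scalerDr !scalerA mulrC; congr (_ + _ *: _).
by field; rewrite !gt_eqF.
Qed.

Lemma hull_sub_convex s A : convex_set A -> [set` s] `<=` A -> hull s `<=` A.
Proof.
move=> cA sA x [w [w0 w1] <-].
have := @convex_set_comb A _ (w 0) (fun i : 'I_(size s) => s`_i) cA w0.
rewrite w1 invr1 scale1r; apply=> // i; apply: sA; exact: mem_nth.
Qed.

Lemma hull_nonempty s : s != [::] -> hull s !=set0.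
Proof.
case: s => // p s _.
exists (\sum_(i < size (p :: s))
  (delta_mx 0 0 : 'rV[R]_(size s).+1) 0 i *: (p :: s)`_i).
exists (delta_mx 0 0) => //; split=> [i|]; first by rewrite mxE.
rewrite (bigD1 0)//= big1 ?addr0 => [|i /negbTE h]; first by rewrite mxE.
by rewrite mxE h andbF.
Qed.

End FiniteHull.

(** * Weighted sums of distances and their minimisers *)

Section Cost.
Context {R : realType} {n : nat}.
Implicit Types (s : seq 'rV[R]_n) (N : 'rV[R]_n -> R).

Definition cost N s (W : 'rV[R]_n -> R) x := \sum_(p <- s) W p * N (x - p).

Lemma seminorm_sub_continuous {N} (p : 'rV[R]_n) :
  seminorm N -> continuous (fun x : 'rV[R]_n => N (x - p)).
Proof.
move=> hN x; apply: (@continuous_comp _ _ _ (fun x : 'rV[R]_n => x - p) N).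
  exact: (@cvgB _ _ _ (nbhs x) _ id (cst p) _ _ (@cvg_id _ (nbhs x)) (cvg_cst p)).
exact: seminorm_continuous.
Qed.

Lemma cost_continuous {N} s W : seminorm N -> continuous (cost N s W).
Proof.
move=> hN; apply: (continuous_big add_continuous) => p _ x.
exact: (@cvgM _ _ (nbhs x) _ (cst (W p)) _ _ _ (cvg_cst _)
  (seminorm_sub_continuous p hN x)).
Qed.

Lemma continuous_min_compact {f : 'rV[R]_n -> R} {A} :
  continuous f -> compact A -> A !=set0 ->
  exists2 x, A x & forall y, A y -> f x <= f y.
Proof.
move=> cf cA A0.
have [x /set_mem Ax xmin] := EVT_min_rV A0 cA (continuous_subspaceT cf).
by exists x => // y /mem_set; exact: xmin.
Qed.

Context (s : seq 'rV[R]_n) (W : 'rV[R]_n -> R).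
Context (W0 : forall p, p \in s -> 0 <= W p).
Context (W1 : \sum_(p <- s) W p = 1).

Lemma ler_cost N M x y : (forall p, p \in s -> N (x - p) <= M (y - p)) ->
  cost N s W x <= cost M s W y.
Proof.
move=> NM; rewrite /cost big_seq [leRHS]big_seq; apply: ler_sum => p ps.
by rewrite ler_wpM2l ?W0 ?NM.
Qed.

(** Some weight is positive as the total is 1: equal costs would make a sum of nonnegative terms
    vanish, and with it every weight. *)
Lemma ltr_cost N M x y : (forall p, p \in s -> N (x - p) < M (y - p)) ->
  cost N s W x < cost M s W y.
Proof.
move=> NM; rewrite lt_neqAle ler_cost ?andbT; last first.
  by move=> p ps; exact/ltW/NM.
apply/eqP => e.
have := W1; suff -> : \sum_(p <- s) W p = 0 by move/esym/eqP; rewrite oner_eq0.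
rewrite big_seq big1 // => p ps.
have : \sum_(q <- s | q \in s) W q * (M (y - q) - N (x - q)) = 0.
  under eq_bigr do rewrite mulrBr.
  by rewrite sumrB -!big_seq -/(cost M s W y) -/(cost N s W x) e subrr.
move=> /eqP; rewrite psumr_eq0; last first.
  by move=> q qs; rewrite mulr_ge0 ?W0// subr_ge0 ltW ?NM.
move=> /allP /(_ p ps); rewrite ps mulf_eq0 => /orP[/eqP//|].
by rewrite subr_eq0 gt_eqF ?NM.
Qed.

(** The triangle inequality and total weight 1 give coercivity, so the sublevel set [D] of the value
    at the origin is compact. Outside [D] the cost is larger still. *)
Lemma cost_min_exists {M d} : seminorm M -> 0 < d -> (forall x, d * `|x| <= M x) ->
  exists x, forall y, cost M s W x <= cost M s W y.
Proof.
move=> hM d0 dM.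
pose D := [set x | cost M s W x <= cost M s W 0].
have [||x Dx xmin] := @continuous_min_compact _ D (cost_continuous s W hM).
- apply: bounded_closed_compact.
    exists ((cost M s W 0 + \sum_(p <- s) W p * M p) / d); split.
      exact: num_real.
    move=> B BM x Dx; apply/ltW/(le_lt_trans _ BM).
    rewrite ler_pdivlMr// mulrC; apply: le_trans (dM x) _.
    suff : M x - \sum_(p <- s) W p * M p <= cost M s W x.
      by move: Dx; rewrite /D /=; lra.
    rewrite -[M x]mul1r -W1 mulr_suml -sumrB /cost big_seq [leRHS]big_seq.
    apply: ler_sum => p ps; rewrite -mulrBr ler_wpM2l ?W0//.
    by have := seminormD hM (x - p) p; rewrite subrK; lra.
  rewrite -[D]/(cost M s W @^-1` [set r | r <= cost M s W 0]).
  apply: preimage_closed => [x _|]; [exact: cost_continuous|exact: closed_le].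
- by exists 0; rewrite /D /=.
exists x => y; have [Dy|/ltW yD] := leP (cost M s W y) (cost M s W 0).
  exact: xmin.
exact: le_trans yD.
Qed.

End Cost.

(** * Medians in the plane *)

Section PlaneMedian.
Context {R : realType}.
Implicit Types x y : 'rV[R]_2.

(** [z] is the Euclidean nearest point of the hull; the inequality is the first-order condition
    along the segment from [z] to [p]. *)
Lemma hull_projection (s : seq 'rV[R]_2) x : s != [::] ->
  exists2 z, hull s z & forall p, p \in s -> dot (x - z) (p - z) <= 0.
Proof.
move=> s0.
have [z Cz zmin] := continuous_min_compact
  (seminorm_sub_continuous x enorm_seminorm)
  (hull_compact s) (hull_nonempty _ s0).
exists z => // p ps; rewrite leNgt; apply/negP => dp.
have key t : 0 <= t <= 1 ->
    0 <= t * (t * dot (p - z) (p - z) - 2 * dot (x - z) (p - z)).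
  move=> t01.
  have := zmin _ (hull_segment _ _ _ _ Cz ps t01).
  rewrite -ler_sqr ?nnegrE ?enorm_ge0// !sqr_enorm /dot !mxE; lra.
pose q := dot (p - z) (p - z); pose b := dot (x - z) (p - z).
have q0 : 0 <= q := dot_ge0 _.
have b0 : 0 <= b := ltW dp.
have bq : 0 < b + q by rewrite ltr_wpDr.
(* This [t] is at most 1 and satisfies [t * q <= b < 2 * b], contradicting [key]. *)
have t0 : 0 < b / (b + q) by rewrite divr_gt0.
have t1 : b / (b + q) <= 1 by rewrite ler_pdivrMr// mul1r lerDl.
have := key (b / (b + q)); rewrite ltW// t1 => /(_ isT).
rewrite pmulr_rge0// -/q -/b => h.
have : b / (b + q) * q <= b.
  by rewrite mulrAC ler_pdivrMr// ler_wpM2l ?lerDr.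
move: dp; rewrite -/b; lra.
Qed.

Context (N : 'rV[R]_2 -> R) (s : seq 'rV[R]_2) (W : 'rV[R]_2 -> R).
Context (hN : seminorm N).
Context (W0 : forall p, p \in s -> 0 <= W p).
Context (W1 : \sum_(p <- s) W p = 1).

Let s_neq0 : s != [::].
Proof.
apply/eqP => s0; move: W1; rewrite s0 big_nil => /esym/eqP.
by rewrite oner_eq0.
Qed.

Lemma perturbed_median_in_hull e x : 0 < e ->
  (forall y, cost (fun v => N v + e * enorm v) s W x <=
             cost (fun v => N v + e * enorm v) s W y) -> hull s x.
Proof.
move=> e0 xmin; have [z Cz zobt] := hull_projection _ x s_neq0.
have [xz|xz] := eqVneq (x - z) 0; first by rewrite (subr0_eq xz).
have [v hv] := shift_decrease _ _ _ hN e0 xz.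
suff : cost (fun v => N v + e * enorm v) s W (x - v) <
       cost (fun v => N v + e * enorm v) s W x by rewrite ltNge xmin.
(* With [a = x - z], [dot a (x - p) = dot a a - dot a (p - z)], which is at least [dot a a]. *)
apply: ltr_cost => // p ps; rewrite addrAC; apply: hv.
by have := zobt p ps; rewrite /dot !mxE; lra.
Qed.

Lemma hull_median : exists2 x, hull s x & forall y, cost N s W x <= cost N s W y.
Proof.
have [x Cx xmin] := continuous_min_compact (cost_continuous s W hN)
  (hull_compact s) (hull_nonempty _ s_neq0).
exists x => // y; apply/ler_addgt0Pr => e e0.
pose c := cost enorm s W y.
have c0 : 0 <= c.
  by rewrite /c /cost big_seq sumr_ge0// => p ps; rewrite mulr_ge0 ?W0 ?enorm_ge0.
(* Chosen so that the perturbation costs at most [e] at the fixed point [y]; [c] may be zero. *)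
pose d := e / (c + 1).
have d0 : 0 < d by rewrite divr_gt0//; lra.
pose M v := N v + d * enorm v.
have hM : seminorm M := seminorm_add (ltW d0) hN enorm_seminorm.
have [z zmin] : exists z, forall y, cost M s W z <= cost M s W y.
  apply: (cost_min_exists _ _ W0 W1 hM d0) => v.
  have := ler_wpM2l (ltW d0) (normr_le_enorm v).
  by have := seminorm_ge0 hN v; rewrite /M; lra.
(* The chain runs from [x] to [z] in the [N]-cost, since [z] lies in the hull, then to the [M]-cost
   of [z], to that of [y], and back to [N] with error [d * c]. *)
apply: le_trans (xmin z (perturbed_median_in_hull _ _ d0 zmin)) _.
apply: (@le_trans _ _ (cost M s W z)).
  apply: ler_cost => // p _; rewrite /M lerDl mulr_ge0 ?enorm_ge0//.
  exact: ltW.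
apply: le_trans (zmin y) _.
have -> : cost M s W y = cost N s W y + d * c.
  rewrite /c /cost mulr_sumr -big_split; apply: eq_bigr => p _.
  by rewrite /M /=; ring.
rewrite lerD2l /d mulrAC ler_pdivrMr; [|lra].
by rewrite ler_wpM2l ?ltW//; lra.
Qed.

End PlaneMedian.

(** * The gauge of a symmetric convex body is a seminorm *)

Section BodyNorm.
Context {R : realType} {n : nat} {K : set 'rV[R]_n}.
Context (hK : symmetric_convex_body K).

Let gauge_set x := [set t : R | 0 < t /\ [set t *: y | y in K] x].

Let symK x : K x -> K (- x).
Proof. by case: hK => _ _ _ {2}-> Kx; exists x. Qed.

Let convK a b x y : 0 <= a -> 0 <= b -> a + b = 1 -> K x -> K y ->
  K (a *: x + b *: y).
Proof.
move=> a0 b0 ab Kx Ky; have a1 : a <= 1 by lra.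
case: hK => _ cK _ _.
have /set_mem := cK x y (Itv01 a0 a1) (mem_set Kx) (mem_set Ky).
rewrite -[conv _ _ _]/(_ *: _ + (1 - _) *: _) /=.
by rewrite (_ : 1 - a = b) //; lra.
Qed.

(** Each [y] near 0 is the midpoint of [z + 2 *: y], close to the interior point [z], and of [- z];
    hence the radius [r / 2]. *)
Let nbhs0K : nbhs (0 : 'rV[R]_n) K.
Proof.
case: hK => _ _ [z /nbhs_ballP [r /= r0 rK]] _.
have Kz : K z by apply: rK; exact: ballxx.
apply/nbhs_ballP; exists (r / 2) => /=; first by rewrite divr_gt0.
move=> y; rewrite -ball_normE /= sub0r normrN => yr.
have -> : y = (2^-1 : R) *: (z + 2 *: y) + (2^-1 : R) *: (- z).
  by apply/rowP => i; rewrite !mxE; field.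
apply: convK; [lra|lra|lra| |exact: symK].
apply: rK; rewrite -ball_normE /= opprD addNKr normrN normrZ gtr0_norm//.
by rewrite mulrC -ltr_pdivlMr.
Qed.

(** Together with the lower bound 0, this makes [inf] a genuine infimum. *)
Let gauge_set_neq0 x : gauge_set x !=set0.
Proof.
have /nbhs_ballP [r /= r0 rK] := nbhs0K.
have x0 : 0 < `|x| + 1 by rewrite ltr_wpDl.
pose t := (`|x| + 1) / r.
have t0 : 0 < t by rewrite divr_gt0.
exists t; split=> //; exists (t^-1 *: x); last first.
  by rewrite scalerA divff ?scale1r ?gt_eqF.
apply: rK; rewrite -ball_normE /= sub0r normrN normrZ gtr0_norm ?invr_gt0//.
by rewrite mulrC ltr_pdivrMr// /t mulrCA divff ?gt_eqF// mulr1 ltrDl.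
Qed.

Let gauge_set_lbound x : has_lbound (gauge_set x).
Proof. by exists 0 => t [/ltW]. Qed.

Let body_norm_le x t : 0 < t -> K (t^-1 *: x) -> body_norm K x <= t.
Proof.
move=> t0 Kx; apply: ge_inf; first exact: gauge_set_lbound.
by split=> //; exists (t^-1 *: x) => //; rewrite scalerA divff ?scale1r ?gt_eqF.
Qed.

Let body_norm_adherent x e : 0 < e ->
  exists t, [/\ 0 < t, K (t^-1 *: x) & t < body_norm K x + e].
Proof.
move=> e0.
have [t [t0 [y Ky <-]] te] := inf_adherent e0
  (conj (gauge_set_neq0 x) (gauge_set_lbound x)).
by exists t; split=> //; rewrite scalerA mulVf ?gt_eqF// scale1r.
Qed.

Lemma body_norm_seminorm : seminorm (body_norm K).
Proof.
have D x y : body_norm K (x + y) <= body_norm K x + body_norm K y.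
  apply/ler_addgt0Pr => e e0.
  have e2 : 0 < e / 2 by rewrite divr_gt0.
  have [t [t0 Kx te]] := body_norm_adherent x _ e2.
  have [r [r0 Ky re]] := body_norm_adherent y _ e2.
  have tr : 0 < t + r by rewrite addr_gt0.
  apply: (@le_trans _ _ (t + r)); last lra.
  apply: body_norm_le => //.
  (* Convexity of [K] gives subadditivity: the rescaled sum is a convex combination of the two
     rescaled points. *)
  have -> : (t + r)^-1 *: (x + y) =
      (t / (t + r)) *: (t^-1 *: x) + (r / (t + r)) *: (r^-1 *: y).
    rewrite !scalerA scalerDr; congr (_ *: _ + _ *: _);
    by field; rewrite !gt_eqF.
  apply: convK => //; rewrite ?divr_ge0 ?ltW//.
  by field; rewrite gt_eqF.
have P c x : 0 < c -> body_norm K (c *: x) <= c * body_norm K x.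
  move=> c0; apply/ler_addgt0Pr => e e0.
  have ec : 0 < e / c by rewrite divr_gt0.
  have [t [t0 Kx te]] := body_norm_adherent x _ ec.
  apply: (@le_trans _ _ (c * t)); last first.
    have -> : c * body_norm K x + e = c * (body_norm K x + e / c).
      by field; rewrite gt_eqF.
    by rewrite ler_pM2l// ltW.
  apply: body_norm_le; first exact: mulr_gt0.
  by rewrite scalerA invfM mulrAC mulVf ?mul1r// gt_eqF.
(* The reverse inequality is [P] for the factor [c^-1] at [c *: x]. *)
have P' c x : 0 < c -> body_norm K (c *: x) = c * body_norm K x.
  move=> c0; apply/eqP; rewrite eq_le P//=.
  have c0' : 0 < c^-1 by rewrite invr_gt0.
  have := P c^-1 (c *: x) c0'.
  by rewrite scalerA mulVf ?gt_eqF// scale1r ler_pdivlMl.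
have S x : body_norm K (- x) <= body_norm K x.
  apply/ler_addgt0Pr => e e0.
  have [t [t0 Kx te]] := body_norm_adherent x _ e0.
  apply: le_trans (ltW te); apply: body_norm_le => //.
  by rewrite scalerN; exact: symK.
have S' x : body_norm K (- x) = body_norm K x.
  by apply/eqP; rewrite eq_le S -{1}[x]opprK S.
split=> // c x; case: (ltrgtP c 0) => [c0|c0|->].
- by rewrite -S' -scaleNr ltr0_norm// P'// oppr_gt0.
- by rewrite gtr0_norm// P'.
- rewrite scale0r normr0 mul0r.
  (* The norm of 0 equals twice itself. *)
  by have := P' 2 0 (ltr0Sn _ _); rewrite scaler0; lra.
Qed.

End BodyNorm.

Theorem theorem1 (R : realType) (K : set 'rV[R]_2)
  (hK : symmetric_convex_body K) : intuitive K.
Proof.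
move=> P _ W [W0 W1].
have [x Cx xmin] := hull_median _ _ _ (body_norm_seminorm hK) W0 W1.
exists x; split; first exact: xmin.
by move=> A [cA PA]; exact: (hull_sub_convex _ _ cA PA).
Qed.
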